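(* Let $\Omega\subset\mathbb{R}^N$ be open and bounded, $T>0$, and $Q_T=\Omega\times(0,T]$. Let $\{\mu_x\}_{x\in\Omega}$ be a family of Lévy measures such that for some constant $\tilde C_\mu>0$, $\int_B|z|^2\mu_x(dz)+\int_{\mathbb{R}^N\setminus B}\mu_x(dz)\le\tilde C_\mu$ for all $x\in\Omega$. Let $F:\Omega\times[0,T]\times\mathbb{R}^N\times\mathbb{S}^N\times\mathbb{R}\to\mathbb{R}$ be continuous and degenerate elliptic, and suppose that $F$ satisfies conditions $(N')$ and $(S')$ given in the context. Let $u\in USC(\mathbb{R}^N\times[0,T])$ be a viscosity subsolution of $$u_t+F(x,t,Du,D^2u,\mathcal{I}[x,t,u])=0\quad\text{in }\Omega\times(0,T)$$ that attains a (global) maximum at $P_0=(x_0,t_0)\in Q_T$. Then for any rectangle $$\mathcal{R}(x_0,t_0)=\{(x,t):\ |x^i-x_0^i|\le a^i\ (i=1,\dots,N),\ t_0-a_0\le t\le t_0\},$$ the set $\mathcal{R}_0(x_0,t_0)$, defined as the rectangle $\mathcal{R}(x_0,t_0)$ less the top face $\{t=t_0\}$, contains a point $P\ne P_0$ such that $u(P)=u(P_0)$.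
   Context: Points of $\mathbb{R}^N$ are written $x=(x^1,\dots,x^N)$; in the definition of the rectangle $a^1,\dots,a^N,a_0>0$. $\mathbb{S}^N$ is the set of real symmetric $N\times N$ matrices, $I$ the identity; $B=\{|z|<1\}\subset\mathbb{R}^N$, $1_B$ its indicator; $B((x_0,t_0),r)$ is the ball of center $(x_0,t_0)$ and radius $r$. A family of Lévy measures $\{\mu_x\}_{x\in\Omega}$ is a family of nonnegative, possibly singular, Borel measures on $\mathbb{R}^N$ with $\sup_{x\in\Omega}\int\min(|z|^2,1)\,\mu_x(dz)<\infty$. $USC(\mathbb{R}^N\times[0,T])$ is the set of upper semicontinuous real functions on $\mathbb{R}^N\times[0,T]$. Degenerate elliptic: $F(x,t,p,X,l_1)\le F(x,t,p,Y,l_2)$ whenever $X\ge Y$, $l_1\ge l_2$, for all $(x,t)$, $p\in\mathbb{R}^N\setminus\{0\}$. $(N')$: for any $(x_0,t_0)\in Q_T$ there exists $\lambda>0$ such that $\lambda+F(x_0,t_0,0,I,\tilde C_\mu)>0$. $(S')$: for any $(x_0,t_0)\in Q_T$ there exist $r_0>0$, $\varepsilon_0>0$ such that for all $0<\varepsilon<\varepsilon_0$, $0<r<r_0$, and all $(x,t)\in B((x_0,t_0),r)$, $|p|\le r$, $l\le\tilde C_\mu$, $$F(x,t,\varepsilon p,\varepsilon I,\varepsilon l)\ge\varepsilon F(x,t,p,I,l).$$ Nonlocal operator: $\mathcal{I}[x,t,u]=\int_{\mathbb{R}^N}\big(u(x+z,t)-u(x,t)-Du(x,t)\cdot z\,1_B(z)\big)\mu_x(dz)$.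 For $0<\delta<1$, $p\in\mathbb{R}^N$: $\mathcal{I}^1_\delta[x,t,u]=\int_{|z|\le\delta}\big(u(x+z,t)-u(x,t)-Du(x,t)\cdot z\,1_B(z)\big)\mu_x(dz)$, $\mathcal{I}^2_\delta[x,t,p,u]=\int_{|z|>\delta}\big(u(x+z,t)-u(x,t)-p\cdot z\,1_B(z)\big)\mu_x(dz)$. Viscosity subsolution: an upper semicontinuous $u:\mathbb{R}^N\times[0,T]\to\mathbb{R}$ such that for every $\phi\in C^2(\mathbb{R}^N\times[0,T])$ for which $u-\phi$ attains a global maximum at $(x,t)\in\Omega\times(0,T)$, and every $0<\delta<1$, $$\phi_t(x,t)+F\big(x,t,D\phi(x,t),D^2\phi(x,t),\mathcal{I}^1_\delta[x,t,\phi]+\mathcal{I}^2_\delta[x,t,D\phi(x,t),u]\big)\le0.$$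
   Formalization: When t0 = T, it is additionally assumed that u(x0,T) is the limsup of u(y,s) as (y,s)→(x0,T) with s<T; without this the claim is false (u the indicator of {t=T}, F=0, μ=0). *)

(* Defs.v *)
From HB Require Import structures.
From mathcomp Require Import all_boot all_order all_algebra.
From mathcomp Require Import all_classical all_reals all_analysis.
Set Implicit Arguments.
Unset Strict Implicit.
Unset Printing Implicit Defensive.
Import Order.TTheory GRing.Theory Num.Theory.
Import numFieldNormedType.Exports.
Local Open Scope classical_set_scope.
Local Open Scope ring_scope.

(* R^N with its Borel sigma-algebra; the carrier is 'rV[R]_N. *)
Definition borelRV (R : realType) (N : nat) :=
  g_sigma_algebraType (@open 'rV[R]_N).

Section Euclidean.
Context {R : realType} {N : nat}.
Implicit Types x y p z : 'rV[R]_N.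

Definition dotp p z : R := \sum_(i < N) p ord0 i * z ord0 i.

(* The library norm on 'rV[R]_N is the sup norm. *)
Definition enorm z : R := Num.sqrt (dotp z z).

Definition unitB : set 'rV[R]_N := [set z | enorm z < 1].

Definition ball_xt (P : 'rV[R]_N * R) (r : R) : set ('rV[R]_N * R) :=
  [set q : 'rV[R]_N * R |
     Num.sqrt (enorm (q.1 - P.1) ^+ 2 + (q.2 - P.2) ^+ 2) < r].

Definition sym_mx (X : 'M[R]_N) : Prop := X^T = X.

Definition mx_ge (X Y : 'M[R]_N) : Prop :=
  forall xi : 'rV[R]_N, 0 <= (xi *m (X - Y) *m xi^T) ord0 ord0.

(* R^N x [0,T] *)
Definition strip (T : R) : set ('rV[R]_N * R) := [set q : 'rV[R]_N * R | 0 <= q.2 <= T].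

Definition usc_on (D : set ('rV[R]_N * R)) (u : 'rV[R]_N * R -> R) : Prop :=
  forall q, D q -> forall a, u q < a ->
    \forall q' \near within D (nbhs q), u q' < a.

Definition Levy_family (Omega : set 'rV[R]_N)
    (mu : 'rV[R]_N -> {measure set (borelRV R N) -> \bar R}) : Prop :=
  (ereal_sup [set (\int[mu x]_z (Num.min (enorm z ^+ 2) 1)%:E)%E
             | x in Omega] < +oo)%E.

Definition Levy_bound (Omega : set 'rV[R]_N)
    (mu : 'rV[R]_N -> {measure set (borelRV R N) -> \bar R}) (C : R) : Prop :=
  forall x, Omega x ->
    (\int[mu x]_(z in unitB) (enorm z ^+ 2)%:E
       + \int[mu x]_(z in ~` unitB) 1 <= C%:E)%E.

Definition C1 (f : 'rV[R]_N * R -> R) : Prop :=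
  forall v, (forall q, derivable f q v) /\ continuous (fun q => 'D_v f q).

(* In finite dimension, having continuous directional derivatives up to order 2
   in all directions is the usual C^2 class.  A C^2 function on R^N x [0,T]
   is represented by a C^2 extension to R^N x R. *)
Definition C2 (f : 'rV[R]_N * R -> R) : Prop :=
  C1 f /\ forall v, C1 (fun q => 'D_v f q).

Definition space_dir (i : 'I_N) : 'rV[R]_N * R := (delta_mx ord0 i, 0).
Definition time_dir : 'rV[R]_N * R := (0, 1).

Definition dt (f : 'rV[R]_N * R -> R) (q : 'rV[R]_N * R) : R :=
  'D_time_dir f q.

Definition grad (f : 'rV[R]_N * R -> R) (q : 'rV[R]_N * R) : 'rV[R]_N :=
  \row_(i < N) 'D_(space_dir i) f q.

Definition hess (f : 'rV[R]_N * R -> R) (q : 'rV[R]_N * R) : 'M[R]_N :=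
  \matrix_(i < N, j < N) 'D_(space_dir i) (fun q' => 'D_(space_dir j) f q') q.

(* Real-valued integrals: the library sends an infinite integral to 0.  When u
   is bounded above on the slice, as it is for the subsolutions considered
   here, the only infinite value nonloc2 can meet is -oo. *)
Definition nonloc1 (mu : {measure set (borelRV R N) -> \bar R}) (delta : R)
    (q : 'rV[R]_N * R) (phi : 'rV[R]_N * R -> R) : R :=
  (\int[mu]_(z in [set z : 'rV[R]_N | enorm z <= delta])
     (phi (q.1 + z, q.2) - phi q - dotp (grad phi q) z * \1_unitB z))%R.

Definition nonloc2 (mu : {measure set (borelRV R N) -> \bar R}) (delta : R)
    (q : 'rV[R]_N * R) (p : 'rV[R]_N) (u : 'rV[R]_N * R -> R) : R :=
  (\int[mu]_(z in [set z : 'rV[R]_N | delta < enorm z])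
     (u (q.1 + z, q.2) - u q - dotp p z * \1_unitB z))%R.

(* A nonlinearity F x t p X l is a total function; only its values for x in
   Omega, 0 <= t <= T and X symmetric are constrained. *)
Definition nonlinearity : Type :=
  'rV[R]_N -> R -> 'rV[R]_N -> 'M[R]_N -> R -> R.

Definition F_continuous (Omega : set 'rV[R]_N) (T : R) (F : nonlinearity) :
    Prop :=
  {within [set w : 'rV[R]_N * R * 'rV[R]_N * 'M[R]_N * R |
             [/\ Omega w.1.1.1.1, 0 <= w.1.1.1.2 <= T & sym_mx w.1.2]],
    continuous
      (fun w => F w.1.1.1.1 w.1.1.1.2 w.1.1.2 w.1.2 w.2)}.

Definition degenerate_elliptic (Omega : set 'rV[R]_N) (T : R)
    (F : nonlinearity) : Prop :=
  forall x t p X Y l1 l2, Omega x -> 0 <= t <= T -> p != 0 ->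
    sym_mx X -> sym_mx Y -> mx_ge X Y -> l2 <= l1 ->
    F x t p X l1 <= F x t p Y l2.

Definition QT (Omega : set 'rV[R]_N) (T : R) : set ('rV[R]_N * R) :=
  [set q : 'rV[R]_N * R | Omega q.1 /\ 0 < q.2 <= T].

Definition condN (Omega : set 'rV[R]_N) (T C : R) (F : nonlinearity) : Prop :=
  forall P0, QT Omega T P0 ->
    exists2 lam : R, 0 < lam & 0 < lam + F P0.1 P0.2 0 1%:M C.

Definition condS (Omega : set 'rV[R]_N) (T C : R) (F : nonlinearity) : Prop :=
  forall P0, QT Omega T P0 ->
    exists r0 eps0 : R, [/\ 0 < r0, 0 < eps0 &
      forall eps r : R, 0 < eps < eps0 -> 0 < r < r0 ->
      forall q p l, ball_xt P0 r q -> Omega q.1 -> 0 <= q.2 <= T ->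
        enorm p <= r -> l <= C ->
        eps * F q.1 q.2 p 1%:M l
          <= F q.1 q.2 (eps *: p) (eps *: 1%:M) (eps * l)].

Definition viscosity_subsolution (Omega : set 'rV[R]_N) (T : R)
    (mu : 'rV[R]_N -> {measure set (borelRV R N) -> \bar R})
    (F : nonlinearity) (u : 'rV[R]_N * R -> R) : Prop :=
  usc_on (strip T) u /\
  forall phi, C2 phi ->
  forall q, Omega q.1 -> 0 < q.2 < T ->
    (forall q', strip T q' -> u q' - phi q' <= u q - phi q) ->
  forall delta, 0 < delta < 1 ->
    dt phi q
      + F q.1 q.2 (grad phi q) (hess phi q)
          (nonloc1 (mu q.1) delta q phi
             + nonloc2 (mu q.1) delta q (grad phi q) u) <= 0.

(* The value at a point of the terminal face is the upper limit of the values
   at earlier times.  Subsolutions in Omega x (0,T) are constrained only for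
   t < T, so without this a jump up at t = T (e.g. the indicator of {t = T},
   with F = 0) is not excluded. *)
Definition terminal_value (T : R) (u : 'rV[R]_N * R -> R) (x : 'rV[R]_N) :
    Prop :=
  limf_esup (fun q => (u q)%:E)
    (within [set q : 'rV[R]_N * R | 0 <= q.2 < T] (nbhs (x, T)))
  = (u (x, T))%:E.

Definition rect (P0 : 'rV[R]_N * R) (a : 'rV[R]_N) (a0 : R) :
    set ('rV[R]_N * R) :=
  [set q : 'rV[R]_N * R |
           (forall i, `|q.1 ord0 i - P0.1 ord0 i| <= a ord0 i) /\
           P0.2 - a0 <= q.2 <= P0.2].

Definition rect0 (P0 : 'rV[R]_N * R) (a : 'rV[R]_N) (a0 : R) :
    set ('rV[R]_N * R) :=
  rect P0 a a0 `\` [set q : 'rV[R]_N * R | q.2 = P0.2].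

End Euclidean.

Arguments nonlinearity : clear implicits.

(* Main.v *)
Require Import Defs.
From HB Require Import structures.
From mathcomp Require Import all_boot all_order all_algebra.
From mathcomp Require Import all_classical all_reals all_analysis.
From mathcomp Require Import measurable_realfun.
From mathcomp Require Import ring lra.
Set Implicit Arguments.
Unset Strict Implicit.
Unset Printing Implicit Defensive.
Import Order.TTheory GRing.Theory Num.Theory.
Import numFieldNormedType.Exports.
Local Open Scope classical_set_scope.
Local Open Scope ring_scope.

(** Suppose that [u] stays below its maximum [M = u P0] on the rectangle less
its top face.  With [s = t - t0], put
  [h = |x - x0| ^ 2 / 2 + 4 lam s + (4 lam / eta) s ^ 2],
where [lam] comes from condition (N') and [eta] is small.  The set where
[h < lam * eta] is a small neighbourhood of [P0] in space-time: there
[|x - x0| ^ 2 < 4 lam eta] and [- 2 eta < s < eta].  Its part with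
[s <= - 3 eta / 8] lies in the rectangle below the top face, so by upper
semicontinuity and compactness [u] is at most [M - c] there for some [c > 0].
The test function is
  [phi = eps * h + eps * lam * eta * (t / T) ^ m].
For [eps] small the global maximum of [u - phi] over the strip is attained,
and at a point [q] where [h < lam * eta] and [s > - 3 eta / 8], so that
[phi_t >= eps * lam] at [q].  The last summand of [phi] keeps [q] away from
the final time [T]: it equals [eps * lam * eta] at time [T], but for [m] large
it is negligible at a point close to [P0], earlier than [T], where [u] is
almost [M]; if [t0 = T] such a point exists because [u P0] is the upper limit
of the values at earlier times ([near_value_before], [localized_max]).

At [q] one has [D phi = eps * p] with [p = x - x0] small and
[D^2 phi = eps * I].  The nonlocal term is at most [eps * C]: on the unit
ball the maximality of [q] bounds the integrand by [eps * |z| ^ 2], and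
outside it by [M - u q <= eps] ([nonlocal_testf_le]).  Writing it
[eps * l'], condition (S'), ellipticity and continuity of [F] give
  [phi_t + F (q, eps p, eps I, eps l') >= eps * (lam + F (q, p, I, C)) > 0],
which contradicts the subsolution inequality.

Measurability of [u] plays no role: the upper bound for the nonlocal term only
involves the integral of a measurable majorant ([integral_le_ge0]). *)

(** * Upper semicontinuous functions on compact sets *)

Lemma usc_on_compact_max (R : realType) (N : nat)
    (D K : set ('rV[R]_N * R)) (v : 'rV[R]_N * R -> R) q0 :
  usc_on D v -> compact K -> K `<=` D -> K q0 ->
  exists2 q, K q & forall q', K q' -> v q' <= v q.
Proof.
move=> uscv cK KD Kq0.
(* The superlevel sets of v in K form a filter base; a cluster point is a
   maximum point. *)
pose B q := [set q' | K q' /\ v q <= v q'].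
have FF : ProperFilter (filter_from K B).
  apply: filter_from_proper; last by move=> q Kq; exists q; split.
  apply: filter_from_filter; first by exists q0.
  move=> i j Ki Kj; have [vij|/ltW vji] := leP (v i) (v j).
    by exists j => // q [Kq vq]; split; split => //; exact: le_trans vq.
  by exists i => // q [Kq vq]; split; split => //; exact: le_trans vq.
have [|p [Kp clp]] := cK _ FF.
  by exists q0 => // q [].
exists p => // q' Kq'; rewrite leNgt; apply/negP => vpq.
have FB : filter_from K B (B q') by exists q'.
have [q [[Kq vq] /(_ (KD _ Kq))]] := clp _ _ FB (uscv p (KD _ Kp) _ vpq).
by rewrite ltNge vq.
Qed.

Lemma usc_onB (R : realType) (N : nat) (D : set ('rV[R]_N * R))
    (u phi : 'rV[R]_N * R -> R) :
  usc_on D u -> continuous phi -> usc_on D (fun q => u q - phi q).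
Proof.
move=> uscu cphi q Dq a uphi; set e := a - (u q - phi q).
have e0 : 0 < e / 2 by rewrite divr_gt0// subr_gt0.
have uq : u q < u q + e / 2 by rewrite ltrDl.
have H1 : \forall q' \near nbhs q, D q' -> u q' < u q + e / 2 := uscu q Dq _ uq.
have H2 : \forall q' \near nbhs q, `|phi q - phi q'| < e / 2.
  by move/cvgrPdist_lt: (cphi q); apply.
suff : \forall q' \near nbhs q, D q' -> u q' - phi q' < a by [].
apply: filterS2 H1 H2 => q' uq' phiq' Dq'; have := uq' Dq'.
by move: phiq'; rewrite ltr_norml => /andP[_]; rewrite /e; lra.
Qed.

Lemma compact_box (R : realType) (N : nat) (x : 'rV[R]_N) (rho t1 t2 : R) :
  compact [set q : 'rV[R]_N * R |
    (forall i, `|q.1 ord0 i - x ord0 i| <= rho) /\ t1 <= q.2 <= t2].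
Proof.
pose A (i : 'I_N) := `[x ord0 i - rho, x ord0 i + rho]%classic.
have -> : [set q : 'rV[R]_N * R |
    (forall i, `|q.1 ord0 i - x ord0 i| <= rho) /\ t1 <= q.2 <= t2] =
  [set y : 'rV[R]_N | forall i, A i (y ord0 i)] `*` `[t1, t2]%classic.
  apply/seteqP; split=> -[y t]/= [Hy Ht]; split=> //= i.
  - by rewrite /A/= in_itv/= -ler_distl.
  - by rewrite ler_distl; have := Hy i; rewrite /A/= in_itv.
apply: compact_setX; last exact: segment_compact.
by apply: rV_compact => i; exact: segment_compact.
Qed.

(** * Polynomial test functions *)

(** Continuous functions with continuous directional derivatives.  Continuity
of the function is recorded so that the class is visibly stable under
products. *)
Definition contC1 {R : realType} {N : nat} (f : 'rV[R]_N * R -> R) :=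
  continuous f /\ C1 f.

(** The analogous class of order two. *)
Definition contC2 {R : realType} {N : nat} (f : 'rV[R]_N * R -> R) :=
  contC1 f /\ forall v, contC1 (fun q => 'D_v f q).

Lemma contC2_C2 (R : realType) (N : nat) (f : 'rV[R]_N * R -> R) :
  contC2 f -> C2 f.
Proof. by move=> [[cf Cf] H]; split=> // v; have [] := H v. Qed.

Lemma contC1_cst (R : realType) (N : nat) (c : R) :
  contC1 (fun _ : 'rV[R]_N * R => c).
Proof.
split=> [q|v]; first exact: cvg_cst.
split=> [q|]; first exact: derivable_cst.
rewrite (_ : (fun q => 'D_v _ q) = (fun=> 0)); first by move=> q; exact: cvg_cst.
by apply/funext => q; exact: derive_cst.
Qed.

Lemma contC2_cst (R : realType) (N : nat) (c : R) :
  contC2 (fun _ : 'rV[R]_N * R => c).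
Proof.
split=> [|v]; first exact: contC1_cst.
rewrite (_ : (fun q => 'D_v _ q) = (fun=> 0)); first exact: contC1_cst.
by apply/funext => q; exact: derive_cst.
Qed.

Lemma contC1D (R : realType) (N : nat) (f g : 'rV[R]_N * R -> R) :
  contC1 f -> contC1 g -> contC1 (fun q => f q + g q).
Proof.
move=> [cf Cf] [cg Cg]; split=> [q|v].
  by apply: cvgD; [exact: cf|exact: cg].
have [df cdf] := Cf v; have [dg cdg] := Cg v.
split=> [q|]; first exact: derivableD.
rewrite (_ : (fun q => 'D_v _ q) = (fun q => 'D_v f q + 'D_v g q)).
  by move=> q; apply: cvgD; [exact: cdf|exact: cdg].
by apply/funext => q; exact: deriveD.
Qed.

Lemma contC1M (R : realType) (N : nat) (f g : 'rV[R]_N * R -> R) :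
  contC1 f -> contC1 g -> contC1 (fun q => f q * g q).
Proof.
move=> [cf Cf] [cg Cg]; split=> [q|v].
  by apply: cvgM; [exact: cf|exact: cg].
have [df cdf] := Cf v; have [dg cdg] := Cg v.
split=> [q|]; first exact: derivableM.
rewrite (_ : (fun q => 'D_v _ q) = (fun q => f q * 'D_v g q + g q * 'D_v f q)).
  by move=> q; apply: cvgD; apply: cvgM;
    [exact: cf|exact: cdg|exact: cg|exact: cdf].
by apply/funext => q; exact: deriveM.
Qed.

Lemma contC2D (R : realType) (N : nat) (f g : 'rV[R]_N * R -> R) :
  contC2 f -> contC2 g -> contC2 (fun q => f q + g q).
Proof.
move=> [C1f Cf] [C1g Cg]; split=> [|v]; first exact: contC1D.
rewrite (_ : (fun q => 'D_v _ q) = (fun q => 'D_v f q + 'D_v g q)).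
  exact: contC1D.
by apply/funext => q; apply: deriveD; [have [] := C1f.2 v|have [] := C1g.2 v].
Qed.

Lemma contC2M (R : realType) (N : nat) (f g : 'rV[R]_N * R -> R) :
  contC2 f -> contC2 g -> contC2 (fun q => f q * g q).
Proof.
move=> [C1f Cf] [C1g Cg]; split=> [|v]; first exact: contC1M.
rewrite (_ : (fun q => 'D_v _ q) = (fun q => f q * 'D_v g q + g q * 'D_v f q)).
  by apply: contC1D; exact: contC1M.
by apply/funext => q; apply: deriveM; [have [] := C1f.2 v|have [] := C1g.2 v].
Qed.

Lemma contC2X (R : realType) (N : nat) (f : 'rV[R]_N * R -> R) m :
  contC2 f -> contC2 (fun q => f q ^+ m).
Proof.
move=> Cf; elim: m => [|m IH].
  by under eq_fun do rewrite expr0; exact: contC2_cst.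
by under eq_fun do rewrite exprS; exact: contC2M.
Qed.

Lemma contC2_sum (R : realType) (N n : nat) (f : 'I_n -> 'rV[R]_N * R -> R) :
  (forall i, contC2 (f i)) -> contC2 (fun q => \sum_(i < n) f i q).
Proof.
elim: n f => [|n IH] f Cf.
  by under eq_fun do rewrite big_ord0; exact: contC2_cst.
by under eq_fun do rewrite big_ord_recr; apply: contC2D => //; exact: IH.
Qed.

(** For a linear function the difference quotients are constant. *)
Lemma is_derive_additive (R : realType) (N : nat) (f : 'rV[R]_N * R -> R) q v :
  (forall (h : R) p w, f (h *: w + p) = h * f w + f p) -> is_derive q v f (f v).
Proof.
move=> fl.
have E : (fun h : R => h^-1 *: (f (h *: v + q) - f q)) @ 0^' --> f v.
  apply: cvg_near_cst; near=> h.
  rewrite fl addrK scalerA mulVf ?scale1r//.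
  by near: h; exact: nbhs_dnbhs_neq.
apply: DeriveDef; first by apply/cvg_ex; exists (f v).
exact: cvg_lim.
Unshelve. all: by end_near.
Qed.

Lemma contC2_additive (R : realType) (N : nat) (f : 'rV[R]_N * R -> R) :
  continuous f ->
  (forall (h : R) p w, f (h *: w + p) = h * f w + f p) -> contC2 f.
Proof.
move=> cf fl; have E v : (fun q => 'D_v f q) = fun=> f v.
  apply/funext => q; have := is_derive_additive q v fl.
  by move=> ?; rewrite derive_val.
split=> [|v]; last by rewrite E; exact: contC1_cst.
split=> // v; split; last by rewrite E; move=> q; exact: cvg_cst.
by move=> q; have [] := is_derive_additive q v fl.
Qed.

Lemma is_derive_coord (R : realType) (N : nat) i (q v : 'rV[R]_N * R) :
  is_derive q v (fun q => q.1 ord0 i) (v.1 ord0 i).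
Proof.
by apply: (@is_derive_additive R N (fun q => q.1 ord0 i)) => h p w /=; rewrite !mxE.
Qed.

Lemma is_derive_time (R : realType) (N : nat) (q v : 'rV[R]_N * R) :
  is_derive q v (fun q => q.2) v.2.
Proof. exact: (@is_derive_additive R N (fun q => q.2)). Qed.

Lemma contC2_coord (R : realType) (N : nat) i :
  contC2 (fun q : 'rV[R]_N * R => q.1 ord0 i).
Proof.
apply: contC2_additive => [q|h p w /=]; last by rewrite !mxE.
apply: (@continuous_comp _ _ _ fst (fun x : 'rV[R]_N => x ord0 i)).
  exact: cvg_fst.
exact: coord_continuous.
Qed.

Lemma contC2_time (R : realType) (N : nat) :
  contC2 (fun q : 'rV[R]_N * R => q.2).
Proof. by apply: contC2_additive => // q; exact: cvg_snd. Qed.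

Lemma dotpZl (R : realType) (N : nat) (c : R) (p z : 'rV[R]_N) :
  dotp (c *: p) z = c * dotp p z.
Proof. by rewrite /dotp mulr_sumr; apply: eq_bigr => i _; rewrite mxE mulrA. Qed.

Lemma dotp_sqrD (R : realType) (N : nat) (x z : 'rV[R]_N) :
  dotp (x + z) (x + z) = dotp x x + 2 * dotp x z + dotp z z.
Proof.
rewrite /dotp mulr_sumr -!big_split/=; apply: eq_bigr => i _.
by rewrite !mxE; ring.
Qed.

(** The test function: a multiple of the squared distance to [x0], plus a
quadratic polynomial and a high power of the time variable. *)
Definition testf {R : realType} {N : nat} (x0 : 'rV[R]_N) (t0 T c A B k : R)
    (m : nat) (q : 'rV[R]_N * R) : R :=
  c / 2 * dotp (q.1 - x0) (q.1 - x0)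
    + (A * (q.2 - t0) + B * (q.2 - t0) ^+ 2 + k * (q.2 / T) ^+ m).

Section TestFunction.
Variables (R : realType) (N : nat) (x0 : 'rV[R]_N) (t0 T c A B k : R) (m : nat).
Local Notation phi := (testf x0 t0 T c A B k m).

Lemma contC2_testf : contC2 phi.
Proof.
have Ct : contC2 (fun q : 'rV[R]_N * R => q.2 - t0).
  by apply: contC2D; [exact: contC2_time|exact: contC2_cst].
have Cx i : contC2 (fun q : 'rV[R]_N * R => (q.1 - x0) ord0 i).
  under eq_fun do rewrite !mxE.
  by apply: contC2D; [exact: contC2_coord|exact: contC2_cst].
have C0 (a : R) : contC2 (fun _ : 'rV[R]_N * R => a) := contC2_cst N a.
have Cd : contC2 (fun q : 'rV[R]_N * R => dotp (q.1 - x0) (q.1 - x0)).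
  exact: (contC2_sum (fun i => contC2M (Cx i) (Cx i))).
have CT : contC2 (fun q : 'rV[R]_N * R => q.2 / T).
  exact: (contC2M (@contC2_time R N) (C0 T^-1)).
exact: (contC2D (contC2M (C0 (c / 2)) Cd)
  (contC2D (contC2D (contC2M (C0 A) Ct) (contC2M (C0 B) (contC2X 2 Ct)))
    (contC2M (C0 k) (contC2X m CT)))).
Qed.

Lemma is_derive_testf (q v : 'rV[R]_N * R) :
  is_derive q v phi (c * dotp (q.1 - x0) v.1 +
   (A + 2 * B * (q.2 - t0) + k * (m%:R * (q.2 / T) ^+ m.-1) / T) * v.2).
Proof.
have Dt : is_derive q v (fun q => q.2 - t0) v.2.
  have := is_deriveD (is_derive_time q v) (is_derive_cst t0 q v).
  have := is_deriveB (is_derive_time q v) (is_derive_cst t0 q v).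
  by rewrite subr0.
have DT : is_derive q v (fun q => q.2 / T) (v.2 / T).
  have := is_deriveM (is_derive_time q v) (is_derive_cst T^-1 q v).
  by move=> h; apply: is_derive_eq h _; rewrite scaler0 add0r /= mulrC.
have Dx i : is_derive q v (fun q => (q.1 - x0) ord0 i) (v.1 ord0 i).
  have -> : (fun q : 'rV[R]_N * R => (q.1 - x0) ord0 i) =
      (fun q => q.1 ord0 i - x0 ord0 i) by apply/funext => p; rewrite !mxE.
  have := is_deriveB (is_derive_coord i q v) (is_derive_cst (x0 ord0 i) q v).
  by rewrite subr0.
have Dd : is_derive q v (fun q => dotp (q.1 - x0) (q.1 - x0))
    (2 * dotp (q.1 - x0) v.1).
  have -> : (fun q : 'rV[R]_N * R => dotp (q.1 - x0) (q.1 - x0)) =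
      \sum_(i < N) ((fun q => (q.1 - x0) ord0 i) ^+ 2).
    by apply/funext => p; rewrite fct_sumE; apply: eq_bigr => i _; rewrite expr2.
  apply: is_derive_eq; rewrite /dotp mulr_sumr; apply: eq_bigr => i _.
  by rewrite expr1 /GRing.scale/=; ring.
have -> : phi = cst (c / 2) * (fun q => dotp (q.1 - x0) (q.1 - x0)) +
  (cst A * (fun q => q.2 - t0) + cst B * (fun q => q.2 - t0) ^+ 2 +
    cst k * (fun q => q.2 / T) ^+ m).
  by apply/funext => p; rewrite /testf !fctE.
have Dc (a : R) : is_derive q v (cst a) 0 := is_derive_cst a q v.
have := is_deriveD (is_deriveM (Dc (c / 2)) Dd)
  (is_deriveD (is_deriveD (is_deriveM (Dc A) Dt)
    (is_deriveM (Dc B) (is_deriveX 2 Dt))) (is_deriveM (Dc k) (is_deriveX m DT))).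
move=> h; apply: is_derive_eq h _; rewrite /GRing.scale/= !fctE/=.
rewrite !mulr0 !addr0 expr1 [c / 2 * _]mulrA divfK ?pnatr_eq0//.
move: (dotp _ _) ((q.2 / T) ^+ m.-1) (q.2 - t0) v.2 => d X s w.
by ring.
Qed.

Lemma dt_testf q :
  dt phi q = A + 2 * B * (q.2 - t0) + k * (m%:R * (q.2 / T) ^+ m.-1) / T.
Proof.
rewrite /dt; have := is_derive_testf q time_dir => h; rewrite derive_val/=.
by rewrite mulr1 /dotp big1 ?mulr0 ?add0r// => i _; rewrite [X in _ * X]mxE mulr0.
Qed.

Lemma derive_space_testf q i :
  'D_(space_dir i) phi q = c * (q.1 - x0) ord0 i.
Proof.
have := is_derive_testf q (space_dir i) => h; rewrite derive_val/= mulr0 addr0.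
rewrite /dotp (bigD1 i)//= big1 => [|j /negbTE ji].
  by rewrite [delta_mx _ _ _ _]mxE !eqxx mulr1 addr0.
by rewrite [delta_mx _ _ _ _]mxE ji andbF mulr0.
Qed.

Lemma grad_testf q : grad phi q = c *: (q.1 - x0).
Proof. by apply/rowP => i; rewrite mxE derive_space_testf [RHS]mxE. Qed.

Lemma hess_testf q : hess phi q = c *: 1%:M.
Proof.
apply/matrixP => i j; rewrite !mxE.
have -> : (fun q' => 'D_(space_dir j) phi q') =
    cst c * ((fun q : 'rV[R]_N * R => q.1 ord0 j) - cst (x0 ord0 j)).
  by apply/funext => p; rewrite derive_space_testf [in LHS]mxE [in LHS]mxE.
have h := is_derive_coord j q (space_dir i).
by rewrite derive_val /GRing.scale/= mulr0 addr0 subr0 mxE eqxx/= eq_sym.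
Qed.

Lemma testf_increment q z : testf x0 t0 T c A B k m (q.1 + z, q.2) - phi q
    = c * dotp (q.1 - x0) z + c / 2 * dotp z z.
Proof.
rewrite /testf/= opprD addrACA subrr addr0 [q.1 + z - x0]addrAC [dotp (_ + z) _]dotp_sqrD.
by field.
Qed.

End TestFunction.

(** * The nonlocal term *)

Lemma enorm_ge0 (R : realType) (N : nat) (z : 'rV[R]_N) : 0 <= enorm z.
Proof. exact: sqrtr_ge0. Qed.

Lemma enorm_sqr (R : realType) (N : nat) (z : 'rV[R]_N) :
  enorm z ^+ 2 = dotp z z.
Proof.
by rewrite /enorm sqr_sqrtr// sumr_ge0// => i _; rewrite -expr2 sqr_ge0.
Qed.

Lemma coord_enorm (R : realType) (N : nat) (z : 'rV[R]_N) i :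
  `|z ord0 i| <= enorm z.
Proof.
rewrite -(@ler_pXn2r _ 2)// ?nnegrE ?enorm_ge0// enorm_sqr real_normK ?num_real//.
rewrite /dotp (bigD1 i)//= -expr2 lerDl sumr_ge0// => j _.
by rewrite -expr2 sqr_ge0.
Qed.

Lemma enorm_continuous (R : realType) (N : nat) :
  continuous (@enorm R N).
Proof.
move=> z; apply: (@continuous_comp _ _ _ (fun z : 'rV[R]_N => dotp z z)).
  apply: (continuous_big (op := +%R) (P := xpredT)) => [|i _ {}z].
    exact: add_continuous.
  by have cz := @coord_continuous R 1 N ord0 i z; exact: (cvgM cz cz).
exact: sqrt_continuous.
Qed.

Lemma borelRV_measurable_continuous (R : realType) (N : nat)
    (f : 'rV[R]_N -> R) (D : set (borelRV R N)) :
  continuous f -> measurable_fun D (f : borelRV R N -> R).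
Proof.
move=> /continuousP cf; apply: (@measurable_funS _ _ _ _ setT) => //.
apply: (measurability _ (RGenOpens.measurableE R)).
move=> _ [_ [a [b ->] <-]]; rewrite setTI.
by apply: sub_sigma_algebra; apply: cf; exact: interval_open.
Qed.

(** Monotonicity of the integral under a nonnegative majorant needs no
measurability. *)
Lemma integral_le_ge0 d (X : measurableType d) (R : realType)
    (mu : {measure set X -> \bar R}) (D : set X) (f g : X -> \bar R) :
  (forall x, D x -> 0 <= g x)%E -> (forall x, D x -> f x <= g x)%E ->
  (\int[mu]_(x in D) f x <= \int[mu]_(x in D) g x)%E.
Proof.
move=> g0 fg; rewrite integralE.
apply: (@le_trans _ _ (\int[mu]_(x in D) f^\+ x)%E).
  by rewrite -[leRHS]adde0; apply: leeD2l; rewrite oppe_le0 integral_ge0.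
rewrite !ge0_integralE//; apply: ereal_sup_le => _ [h hf <-]; exists h => // x.
apply: (le_trans (hf x)); rewrite /patch; case: ifPn => //; rewrite inE => Dx.
by rewrite funeposE ge_max g0// fg.
Qed.

(** Since [fine] sends infinite values to 0, a nonnegative bound survives when
the integral is [-oo]. *)
Lemma fine_integral_le (R : realType) (a : \bar R) (b : R) :
  0 <= b -> (a <= b%:E)%E -> fine a <= b.
Proof. by move=> b0; case: a. Qed.

(** The bound of the Levy measure, applied to the majorant
[e * min (|z| ^ 2, 1)] of the two integrands. *)
Lemma nonlocal_le (R : realType) (N : nat)
    (mu : {measure set (borelRV R N) -> \bar R}) (C e delta : R)
    (f1 f2 : 'rV[R]_N -> R) :
  (\int[mu]_(z in unitB) (enorm z ^+ 2)%:E + \int[mu]_(z in ~` unitB) 1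
    <= C%:E)%E ->
  0 <= e -> delta < 1 ->
  (forall z, enorm z <= delta -> f1 z <= e * enorm z ^+ 2) ->
  (forall z, delta < enorm z -> enorm z < 1 -> f2 z <= e * enorm z ^+ 2) ->
  (forall z, 1 <= enorm z -> f2 z <= e) ->
  \int[mu]_(z in [set z : 'rV[R]_N | enorm z <= delta]) f1 z +
  \int[mu]_(z in [set z : 'rV[R]_N | delta < enorm z]) f2 z <= e * C.
Proof.
move=> hC e0 d1 h1 h2 h3.
pose G (z : borelRV R N) : R := Num.min (enorm z ^+ 2) 1.
have G0 z : 0 <= G z by rewrite le_min sqr_ge0 ler01.
have me D : measurable_fun D (@enorm R N : borelRV R N -> R).
  by apply: borelRV_measurable_continuous; exact: enorm_continuous.
have mG D : measurable_fun D (EFin \o G).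
  apply/measurable_EFinP; apply: measurable_minr => //.
  exact: measurable_funX.
set A := [set z : 'rV[R]_N | enorm z <= delta].
set D := [set z : 'rV[R]_N | delta < enorm z].
have mA : measurable (A : set (borelRV R N)).
  rewrite (_ : A = setT `&` (@enorm R N) @^-1` `]-oo, delta]); last first.
    by apply/seteqP; split=> z; rewrite /A/= in_itv/=; [|case].
  exact: me.
have mB : measurable (@unitB R N : set (borelRV R N)).
  rewrite (_ : unitB = setT `&` (@enorm R N) @^-1` `]-oo, 1[); last first.
    by apply/seteqP; split=> z; rewrite /unitB/= in_itv/=; [|case].
  exact: me.
have DE : D = ~` A.
  by apply/seteqP; split=> z; rewrite /D/A/= ltNge => /negP.
have GB z : enorm z < 1 -> G z = enorm z ^+ 2.
  by move=> z1; apply/min_idPl; rewrite expr_le1 ?enorm_ge0// ltW.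
have GC z : 1 <= enorm z -> G z = 1.
  by move=> z1; apply/min_idPr; rewrite expr_ge1 ?enorm_ge0.
have split_int S : measurable (S : set (borelRV R N)) ->
    (\int[mu]_z (G z)%:E = \int[mu]_(z in S) (G z)%:E + \int[mu]_(z in ~` S) (G z)%:E)%E.
  move=> mS; rewrite -ge0_integral_setU ?setUv//; first exact: measurableC.
  - by move=> z _; rewrite lee_fin.
  - by rewrite disj_set2E setICr.
have IC : (\int[mu]_z (G z)%:E <= C%:E)%E.
  rewrite (split_int unitB mB); apply: le_trans hC; apply: leeD.
    by apply: integral_le_ge0 => z; rewrite /unitB/= => z1; rewrite ?lee_fin ?sqr_ge0 ?GB.
  apply: integral_le_ge0 => z; rewrite /unitB/= => /negP; rewrite -leNgt => z1.
    by rewrite lee_fin.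
  by rewrite GC.
rewrite (split_int A mA) -DE in IC.
have pos S : (0 <= \int[mu]_(z in S) (G z)%:E)%E.
  by apply: integral_ge0 => z _; rewrite lee_fin.
have fA : (\int[mu]_(z in A) (G z)%:E)%E \is a fin_num.
  rewrite ge0_fin_numE//; apply: le_lt_trans (ltry C).
  by apply: le_trans IC; rewrite leeDl.
have fD : (\int[mu]_(z in D) (G z)%:E)%E \is a fin_num.
  rewrite ge0_fin_numE//; apply: le_lt_trans (ltry C).
  by apply: le_trans IC; rewrite leeDr.
have key S (f : 'rV[R]_N -> R) : measurable (S : set (borelRV R N)) ->
    (\int[mu]_(z in S) (G z)%:E)%E \is a fin_num ->
    (forall z, S z -> f z <= e * G z) ->
    \int[mu]_(z in S) f z <= e * fine (\int[mu]_(z in S) (G z)%:E)%E.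
  move=> mS fS fG; apply: fine_integral_le.
    by rewrite mulr_ge0// fine_ge0.
  rewrite EFinM fineK// -ge0_integralZl_EFin//; last by move=> z _; rewrite lee_fin.
  apply: integral_le_ge0 => z Sz; rewrite -EFinM lee_fin; first exact: mulr_ge0.
  exact: fG.
apply: (@le_trans _ _ (e * fine (\int[mu]_(z in A) (G z)%:E)%E +
                       e * fine (\int[mu]_(z in D) (G z)%:E)%E)).
  apply: lerD; apply: key => //.
  - by move=> z Az; rewrite GB ?h1//; exact: le_lt_trans d1.
  - by rewrite DE; exact: measurableC.
  - move=> z Dz; have [z1|z1] := ltP (enorm z) 1; first by rewrite GB// h2.
    by rewrite GC// mulr1 h3.
rewrite -mulrDr ler_wpM2l// -lee_fin EFinD !fineK//.
Qed.

(** * The nonlinearity at the identity matrix *)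

(** Continuity at a zero gradient, with the last two arguments kept fixed, in
terms of coordinates. *)
Lemma F_near_at0 (R : realType) (N : nat) (Omega : set 'rV[R]_N) (T : R)
    (F : nonlinearity R N) (x0 : 'rV[R]_N) (t0 l e : R) :
  F_continuous Omega T F -> Omega x0 -> 0 <= t0 <= T -> 0 < e ->
  exists2 rho : R, 0 < rho & forall (x : 'rV[R]_N) (t : R) (p : 'rV[R]_N),
    Omega x -> 0 <= t <= T ->
    (forall i, `|x ord0 i - x0 ord0 i| <= rho) -> `|t - t0| <= rho ->
    (forall i, `|p ord0 i| <= rho) ->
    `|F x t p 1%:M l - F x0 t0 0 1%:M l| < e.
Proof.
move=> /subspace_continuousP cF Ox0 t0T e0.
have Dw0 : [/\ Omega x0, 0 <= t0 <= T & @sym_mx R N 1%:M].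
  by split=> //; exact: trmx1.
have /cvgrPdist_lt/(_ _ e0) := cF (x0, t0, 0, 1%:M, l) Dw0.
rewrite /within/= => /nbhs_ballP[r /= r0 rF].
exists (r / 2); first by rewrite divr_gt0.
have r2 : r / 2 < r by rewrite ltr_pdivrMr// ltr_pMr// ltr1n.
move=> x t p Ox tT xx0 tt0 pp; rewrite distrC.
apply: (rF (x, t, p, 1%:M, l)); last by split=> //; exact: trmx1.
split; last exact: ballxx.
split; last exact: ballxx.
split; last first.
  by split=> // i j; rewrite /ball/= mxE ord1 sub0r normrN (le_lt_trans (pp j)).
split; last by rewrite /ball/= distrC (le_lt_trans tt0).
by split=> // i j; rewrite /ball/= ord1 distrC (le_lt_trans (xx0 j)).
Qed.

(** Degenerate ellipticity only speaks of nonzero gradients; continuity of the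
nonlinearity extends it to the zero gradient. *)
Lemma elliptic_nonlocal (R : realType) (N : nat) (Omega : set 'rV[R]_N) (T : R)
    (F : nonlinearity R N) (x : 'rV[R]_N) (t : R) (p : 'rV[R]_N) (l1 l2 : R) :
  (0 < N)%N ->
  F_continuous Omega T F -> degenerate_elliptic Omega T F ->
  Omega x -> 0 <= t <= T -> l2 <= l1 ->
  F x t p 1%:M l1 <= F x t p 1%:M l2.
Proof.
move=> N0 Fc Fe Ox tT l12.
have ge1 : @mx_ge R N 1%:M 1%:M.
  by move=> xi; rewrite subrr mulmx0 mul0mx mxE.
have sym1 : @sym_mx R N 1%:M by exact: trmx1.
have [->|p0] := eqVneq p 0; last exact: (Fe _ _ _ _ _ _ _ Ox tT p0).
rewrite leNgt; apply/negP => lF.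
have e0 : 0 < (F x t 0 1%:M l1 - F x t 0 1%:M l2) / 2.
  by rewrite divr_gt0// subr_gt0.
have [r1 r10 H1] := F_near_at0 l1 Fc Ox tT e0.
have [r2 r20 H2] := F_near_at0 l2 Fc Ox tT e0.
pose r := Num.min r1 r2.
have r0 : 0 < r by rewrite lt_min r10.
pose q : 'rV[R]_N := const_mx r.
have q0 : q != 0.
  apply/eqP => /rowP/(_ (Ordinal N0)); rewrite !mxE => rE.
  by move: r0; rewrite rE ltxx.
have qr i : `|q ord0 i| = r by rewrite mxE gtr0_norm.
have := Fe x t q _ _ l1 l2 Ox tT q0 sym1 sym1 ge1 l12.
have dist0 (c s : R) : 0 < s -> `|c - c| <= s.
  by move=> s0; rewrite subrr normr0 ltW.
have q1 i : `|q ord0 i| <= r1 by rewrite qr ge_min lexx.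
have q2 i : `|q ord0 i| <= r2 by rewrite qr ge_min lexx orbT.
have := H1 x t q Ox tT (fun i => dist0 _ _ r10) (dist0 _ _ r10) q1.
have := H2 x t q Ox tT (fun i => dist0 _ _ r20) (dist0 _ _ r20) q2.
rewrite !ltr_norml => /andP[_ A1] /andP[A2 _].
by lra.
Qed.

(** * Localization of the maximum points *)

(** Points before the terminal time, arbitrarily close to [P0], at which [u]
almost reaches its value at [P0]. *)
Lemma near_value_before (R : realType) (N : nat) (Omega : set 'rV[R]_N)
    (T : R) (u : 'rV[R]_N * R -> R) P0 (U : set ('rV[R]_N * R)) kappa :
  QT Omega T P0 -> (P0.2 = T -> terminal_value T u P0.1) ->
  nbhs P0 U -> 0 < kappa ->
  exists P, [/\ U P, 0 <= P.2 < T & u P0 - kappa < u P].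
Proof.
case: P0 => x0 t0 [/= _ /andP[t00 t0T]] hterm nU k0.
have [tT|tT] := eqVneq t0 T; last first.
  exists (x0, t0); split; first exact: nbhs_singleton.
    by rewrite (ltW t00) lt_neqAle tT.
  by rewrite ltrBlDr ltrDl.
have := hterm tT; rewrite tT /terminal_value in nU *.
rewrite /limf_esup => limE.
set S := [set q : 'rV[R]_N * R | 0 <= q.2 < T].
have FU : within S (nbhs (x0, T)) (U `&` S).
  by rewrite /within/=; apply: filterS nU => q Uq Sq.
have : ((u (x0, T) - kappa)%:E
    < ereal_sup ((fun q => (u q)%:E) @` (U `&` S)))%E.
  apply: (@lt_le_trans _ _ (u (x0, T))%:E).
    by rewrite lte_fin ltrBlDr ltrDl.
  by rewrite -limE; apply: ereal_inf_lbound; exists (U `&` S).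
by move=> /ereal_sup_gt[_ [q [Uq Sq] <-]]; rewrite lte_fin => uq; exists q.
Qed.

Lemma exists_small_power (R : realType) (y e : R) :
  0 <= y < 1 -> 0 < e -> exists m, y ^+ m < e.
Proof.
move=> /andP[y0 y1] e0.
have : (fun n => y ^+ n) @ \oo --> (0 : R) by apply: cvg_expr; rewrite ger0_norm.
move=> /cvgrPdist_lt/(_ _ e0)[m _ /(_ m (leqnn m))].
by rewrite /= sub0r normrN ger0_norm ?exprn_ge0// => ?; exists m.
Qed.

Lemma open_box (R : realType) (N : nat) (Omega : set 'rV[R]_N) (x0 : 'rV[R]_N) :
  open Omega -> Omega x0 -> exists2 rho : R, 0 < rho &
    forall x : 'rV[R]_N, (forall i, `|x ord0 i - x0 ord0 i| <= rho) -> Omega x.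
Proof.
move=> oO Ox0; have /nbhs_ballP[r /= r0 rO] := open_nbhs_nbhs (conj oO Ox0).
exists (r / 2); first by rewrite divr_gt0.
have r2 : r / 2 < r by rewrite ltr_pdivrMr// ltr_pMr// ltr1n.
move=> x xx0; apply: rO; split=> // i j.
by rewrite /ball/= ord1 distrC (le_lt_trans (xx0 j)).
Qed.

Lemma positive_lower_bound (R : realType) (N : nat) (a : 'rV[R]_N) :
  (forall i, 0 < a ord0 i) -> exists2 rho : R, 0 < rho &
    forall i, rho <= a ord0 i.
Proof.
move=> a0; exists (\big[Order.min/1]_(i < N) a ord0 i).
  by apply: lt_bigmin => // i _; exact: a0.
by move=> i; exact: bigmin_le.
Qed.

(** The minimum of the time profile [4 lam s + (4 lam / eta) s ^ 2] of the test
function is attained at [s = - eta / 2]. *)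
Lemma profile_ge (R : realType) (lam eta s : R) : 0 < lam -> 0 < eta ->
  - (lam * eta) <= 4 * lam * s + 4 * lam / eta * s ^+ 2.
Proof.
move=> l0 e0; rewrite -subr_ge0.
have -> : 4 * lam * s + 4 * lam / eta * s ^+ 2 - - (lam * eta) =
    4 * lam / eta * (s + eta / 2) ^+ 2 by field; rewrite gt_eqF.
by rewrite mulr_ge0 ?sqr_ge0// divr_ge0 ?mulr_ge0// ltW.
Qed.

Lemma profile_lt (R : realType) (lam eta s : R) : 0 < lam -> 0 < eta ->
  4 * lam * s + 4 * lam / eta * s ^+ 2 < lam * eta -> - (2 * eta) < s < eta.
Proof.
move=> l0 e0 H.
have {}H : 4 * s * eta + 4 * s ^+ 2 < eta ^+ 2.
  have le0 : 0 < lam / eta by rewrite divr_gt0.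
  rewrite -(ltr_pM2l le0); move: H; congr (_ < _).
    by field; rewrite gt_eqF.
  by field; rewrite gt_eqF.
by apply/andP; split; rewrite ltNge; apply/negP => h; nra.
Qed.

(** The test function with parameters [eps] and [m] touches [u] from above, up
to a constant, at a point close to [(x0, t0)] in space, not much earlier in
time and strictly before [T]. *)
Lemma localized_max (R : realType) (N : nat) (Omega : set 'rV[R]_N) (T : R)
    (u : 'rV[R]_N * R -> R) (x0 : 'rV[R]_N) (t0 lam eta rho eps1 : R) :
  usc_on (strip T) u -> QT Omega T (x0, t0) ->
  (forall q, strip T q -> u q <= u (x0, t0)) ->
  (t0 = T -> terminal_value T u x0) ->
  0 < lam -> 0 < eta -> 0 < rho -> 4 * lam * eta <= rho ^+ 2 -> 2 * eta < t0 ->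
  (forall q : 'rV[R]_N * R, (forall i, `|q.1 ord0 i - x0 ord0 i| <= rho) ->
    t0 - 2 * eta <= q.2 <= t0 - 3 / 8 * eta -> u q < u (x0, t0)) ->
  0 < eps1 ->
  exists eps m q, [/\ 0 < eps < eps1, 0 < q.2 < T,
    enorm (q.1 - x0) <= rho, - (3 / 8 * eta) < q.2 - t0 < eta &
    u (x0, t0) - 2 * eps * (lam * eta) < u q /\
    let phi := testf x0 t0 T eps (4 * lam * eps) (4 * lam * eps / eta)
      (eps * (lam * eta)) m in
    forall q', strip T q' -> u q' - phi q' <= u q - phi q].
Proof.
move=> uscu QP0 hmax hterm l0 e0 rho0 lerho et0 hlt eps10.
set M := u (x0, t0) in hmax hlt *.
have [_ /andP[/= t00 t0T]] := QP0.
have T0 : 0 < T by exact: lt_le_trans t0T.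
have le0 : 0 < lam * eta by exact: mulr_gt0.
(* By compactness u stays below M by a positive amount on the early part of
   the box. *)
have [c c0 hc] : exists2 c, 0 < c & forall q : 'rV[R]_N * R,
    (forall i, `|q.1 ord0 i - x0 ord0 i| <= rho) ->
    t0 - 2 * eta <= q.2 <= t0 - 3 / 8 * eta -> u q <= M - c.
  have cK := @compact_box R N x0 rho (t0 - 2 * eta) (t0 - 3 / 8 * eta).
  have KD : [set q : 'rV[R]_N * R |
      (forall i, `|q.1 ord0 i - x0 ord0 i| <= rho) /\
      t0 - 2 * eta <= q.2 <= t0 - 3 / 8 * eta] `<=` strip T.
    by move=> q /= [_ /andP[q1 q2]]; rewrite /strip/=; apply/andP; split; lra.
  have [|q [Kq1 Kq2] qmax] := usc_on_compact_max (q0 := (x0, t0 - eta)) uscu cK KD.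
    split=> [i|]/=; first by rewrite subrr normr0 ltW.
    by apply/andP; split; lra.
  exists (M - u q); first by rewrite subr_gt0 hlt.
  by move=> q' h1 h2; rewrite subKr; apply: qmax.
(* On the part of the box where u <= M - c, the oscillation of eps * h is too
   small for u - phi to reach M - kap. *)
pose eps := Num.min (eps1 / 2) (c / (4 * (lam * eta))).
have eps0 : 0 < eps by rewrite lt_min !divr_gt0// mulr_gt0.
have epslt : eps < eps1.
  by rewrite gt_min ltr_pdivrMr// ltr_pMr// ltr1n.
have epsc : 2 * eps * (lam * eta) < c.
  have : eps <= c / (4 * (lam * eta)) by rewrite ge_min lexx orbT.
  by rewrite ler_pdivlMr ?mulr_gt0//; nra.
pose kap := eps * (lam * eta).
have kap0 : 0 < kap by exact: mulr_gt0.
pose h (q : 'rV[R]_N * R) : R := enorm (q.1 - x0) ^+ 2 / 2 +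
  (4 * lam * (q.2 - t0) + 4 * lam / eta * (q.2 - t0) ^+ 2).
have testfE k m q :
    testf x0 t0 T eps (4 * lam * eps) (4 * lam * eps / eta) k m q =
    eps * h q + k * (q.2 / T) ^+ m.
  rewrite /testf /h -enorm_sqr; move: (_ ^+ m) (enorm _) => X Y.
  by field; rewrite gt_eqF.
have hge q : - (lam * eta) <= h q.
  by have := profile_ge (q.2 - t0) l0 e0; have := sqr_ge0 (enorm (q.1 - x0)); rewrite /h; lra.
(* A competitor before the terminal time where u is almost M. *)
have [[x1 t1] [/= hP1 /andP[t10 t1T] uP1]] :
    exists P, [/\ eps * h P < kap / 3, 0 <= P.2 < T & M - kap / 3 < u P].
  have k30 : 0 < kap / 3 by rewrite divr_gt0.
  apply: (near_value_before QP0 hterm _ k30).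
  pose psi : 'rV[R]_N * R -> R :=
    testf x0 t0 T eps (4 * lam * eps) (4 * lam * eps / eta) 0 0.
  have cpsi : continuous psi by have [[]] := contC2_testf x0 t0 T eps
      (4 * lam * eps) (4 * lam * eps / eta) 0 0.
  have psiE q : psi q = eps * h q by rewrite /psi testfE mul0r addr0.
  have psi0 : psi (x0, t0) = 0.
    rewrite psiE /h/= !subrr expr0n/= !mulr0 !addr0 enorm_sqr.
    by rewrite /dotp big1 ?mul0r ?mulr0// => i _; rewrite mxE mulr0.
  have /cvgrPdist_lt/(_ _ k30) := cpsi (x0, t0).
  apply: filterS => q; rewrite psi0 sub0r normrN psiE.
  exact/le_lt_trans/ler_norm.
have [m hm] : exists m, (t1 / T) ^+ m < 1 / 3.
  apply: exists_small_power; last by rewrite divr_gt0.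
  by rewrite divr_ge0 ?(ltW T0)//= ltr_pdivrMr// mul1r.
pose phi := testf x0 t0 T eps (4 * lam * eps) (4 * lam * eps / eta) kap m.
have phiE q : phi q = eps * h q + kap * (q.2 / T) ^+ m by exact: testfE.
have pow0 (q : 'rV[R]_N * R) : strip T q -> 0 <= kap * (q.2 / T) ^+ m.
  move=> /andP[q20 _]; apply: mulr_ge0; first exact: ltW.
  by rewrite exprn_ge0// divr_ge0// ltW.
have VP1 : M - kap < u (x1, t1) - phi (x1, t1).
  rewrite phiE/=; have : kap * (t1 / T) ^+ m < kap / 3.
    by rewrite ltr_pM2l// -[3^-1]mul1r.
  by move: hP1 uP1; lra.
have SP1 : strip T (x1, t1) by rewrite /strip/= t10 ltW.
(* Points where u - phi exceeds M - kap satisfy h < lam * eta. *)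
have loc q : strip T q -> M - kap < u q - phi q ->
    [/\ enorm (q.1 - x0) <= rho, - (2 * eta) < q.2 - t0 < eta &
        M - 2 * eps * (lam * eta) < u q].
  move=> Sq Vq; have := hmax q Sq; have := pow0 q Sq.
  move: Vq; rewrite phiE => Vq pq uq.
  have hq : h q < lam * eta.
    by rewrite -(ltr_pM2l eps0) -/kap; lra.
  split.
  - rewrite -(@ler_pXn2r _ 2)// ?nnegrE ?enorm_ge0// ?(ltW rho0)//.
    apply: le_trans lerho.
    by have := profile_ge (q.2 - t0) l0 e0; move: hq; rewrite /h; lra.
  - apply: profile_lt l0 e0 _; move: hq; rewrite /h.
    by have := sqr_ge0 (enorm (q.1 - x0)); lra.
  - have := hge q; rewrite -(ler_pM2l eps0) mulrN -/kap.
    have -> : 2 * eps * (lam * eta) = 2 * kap by rewrite /kap mulrA.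
    by lra.
have box (q : 'rV[R]_N * R) : enorm (q.1 - x0) <= rho ->
    forall i, `|q.1 ord0 i - x0 ord0 i| <= rho.
  move=> qrho i; have := coord_enorm (q.1 - x0) i; rewrite !mxE => /le_trans.
  exact.
have [q [Kq Sq] qmax] : exists2 q : 'rV[R]_N * R,
    (forall i, `|q.1 ord0 i - x0 ord0 i| <= rho) /\ 0 <= q.2 <= T &
    forall q' : 'rV[R]_N * R,
    (forall i, `|q'.1 ord0 i - x0 ord0 i| <= rho) /\ 0 <= q'.2 <= T ->
    u q' - phi q' <= u q - phi q.
  have uscv : usc_on (strip T) (fun q => u q - phi q).
    by apply: usc_onB => //; have [[]] := contC2_testf x0 t0 T eps
      (4 * lam * eps) (4 * lam * eps / eta) kap m.
  have [|//|q Kq qmax] := usc_on_compact_max (q0 := (x1, t1)) uscv (@compact_box R N x0 rho 0 T).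
    by move=> q [].
  - by split=> //; apply: box; have [] := loc _ SP1 VP1.
  - by exists q.
have Vq : M - kap < u q - phi q.
  apply: (lt_le_trans VP1); apply: qmax; split=> //.
  by apply: box; have [] := loc _ SP1 VP1.
have [qrho /andP[s1 s2] uq] := loc q Sq Vq.
exists eps, m, q; split=> //.
- by rewrite eps0.
- have /andP[_] := Sq; rewrite le_eqVlt => /orP[/eqP qT|->]; last first.
    by rewrite andbT; move: s1 et0; lra.
  (* At time T the profile is nonnegative and the power is 1. *)
  exfalso; move: Vq; apply/negP; rewrite -leNgt phiE qT divff ?gt_eqF//.
  rewrite expr1n mulr1; have uM := hmax q Sq.
  have : 0 <= eps * h q.
    apply: mulr_ge0; first exact: ltW.
    have s0 : 0 <= q.2 - t0 by rewrite qT subr_ge0.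
    rewrite /h !addr_ge0// ?divr_ge0 ?sqr_ge0//.
      by rewrite mulr_ge0// mulr_ge0// ltW.
    by rewrite mulr_ge0 ?sqr_ge0// divr_ge0 ?mulr_ge0// ltW.
  by move: uM; lra.
- rewrite s2 andbT ltNge; apply/negP => qearly.
  have uc : u q <= M - c by apply: hc => //; apply/andP; split; lra.
  have := hge q; rewrite -(ler_pM2l eps0) mulrN -/kap => hq.
  have := pow0 q Sq; move: Vq; rewrite phiE.
  have : 2 * kap < c by rewrite /kap mulrA.
  by move: uc hq; lra.
- split=> // q' Sq'; have [Vq'|Vq'] := ltP (M - kap) (u q' - phi q').
    by apply: qmax; split=> //; apply: box; have [] := loc _ Sq' Vq'.
  exact: le_trans Vq' (ltW Vq).
Qed.

(** * The strong maximum principle *)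

(** Maximality of [u - phi] at [q] bounds the integrand of [u] by that of [phi] on
the unit ball; outside the unit ball the bound is [M - u q <= c]. *)
Lemma nonlocal_testf_le (R : realType) (N : nat) (T C M c t0 : R)
    (mu : {measure set (borelRV R N) -> \bar R}) (u : 'rV[R]_N * R -> R)
    (x0 : 'rV[R]_N) (A B k : R) (m : nat) (q : 'rV[R]_N * R) (delta : R) :
  (\int[mu]_(z in unitB) (enorm z ^+ 2)%:E + \int[mu]_(z in ~` unitB) 1
    <= C%:E)%E ->
  0 < c -> delta < 1 -> strip T q ->
  (forall q', strip T q' -> u q' <= M) -> M - c <= u q ->
  let phi := testf x0 t0 T c A B k m in
  (forall q', strip T q' -> u q' - phi q' <= u q - phi q) ->
  nonloc1 mu delta q phi + nonloc2 mu delta q (grad phi q) u <= c * C.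
Proof.
move=> hC c0 d1 Sq uM uq phi qmax; have c0' := ltW c0.
have inB (z : 'rV[R]_N) : enorm z < 1 -> \1_unitB z = 1 :> R.
  by move=> z1; rewrite indicE mem_set.
have half (z : 'rV[R]_N) : c / 2 * enorm z ^+ 2 <= c * enorm z ^+ 2.
  by rewrite ler_wpM2r ?sqr_ge0// ler_pdivrMr// ler_peMr// ler1n.
have incr (z : 'rV[R]_N) : phi (q.1 + z, q.2) - phi q - dotp (grad phi q) z =
    c / 2 * enorm z ^+ 2.
  by rewrite testf_increment grad_testf dotpZl enorm_sqr addrAC subrr add0r.
apply: nonlocal_le => // z.
- move=> zd; rewrite inB ?mulr1; last exact: le_lt_trans d1.
  by rewrite incr.
- move=> _ z1; rewrite inB ?mulr1//; apply: le_trans (half z); rewrite -incr.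
  have := qmax (q.1 + z, q.2) Sq.
  by move: (phi (_, _)) (phi q) (dotp _ _) (u (_, _)) => ? ? ? ?; lra.
- move=> z1; rewrite indicE memNset ?mulr0 ?subr0; last first.
    by rewrite /unitB/=; apply/negP; rewrite -leNgt.
  have := uM (q.1 + z, q.2) Sq; move: (u (_, _)) => ?; lra.
Qed.

Unset Implicit Arguments.

Theorem theorem12 (R : realType) (N : nat) (hN : (0 < N)%N)
    (Omega : set 'rV[R]_N) (hopen : open Omega) (hbdd : bounded_set Omega)
    (T : R) (hT : 0 < T)
    (mu : 'rV[R]_N -> {measure set (borelRV R N) -> \bar R})
    (hLevy : Levy_family Omega mu)
    (C : R) (hC : 0 < C) (hmu : Levy_bound Omega mu C)
    (F : nonlinearity R N)
    (hFcont : F_continuous Omega T F)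
    (hFell : degenerate_elliptic Omega T F)
    (hN' : condN Omega T C F) (hS' : condS Omega T C F)
    (u : 'rV[R]_N * R -> R)
    (husub : viscosity_subsolution Omega T mu F u)
    (P0 : 'rV[R]_N * R) (hP0 : QT Omega T P0)
    (hmax : forall q, strip T q -> u q <= u P0)
    (hterm : P0.2 = T -> terminal_value T u P0.1)
    (a : 'rV[R]_N) (ha : forall i, 0 < a ord0 i) (a0 : R) (ha0 : 0 < a0) :
  exists P : 'rV[R]_N * R,
    [/\ strip T P, rect0 P0 a a0 P, P <> P0 & u P = u P0].
Proof.
move: P0 hP0 hmax hterm => [x0 t0] QP0 hmax hterm.
have [/= Ox0 /andP[t00 t0T]] := QP0.
apply: contrapT => noP.
have hlt q : strip T q -> rect0 (x0, t0) a a0 q -> u q < u (x0, t0).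
  move=> Sq Rq; rewrite lt_neqAle hmax// andbT; apply/eqP => uq.
  by apply: noP; exists q; split=> // qE; case: Rq => _; apply; rewrite qE.
have [lam l0 lF] := hN' _ QP0.
have [r0 [eps0 [r00 eps00 HS]]] := hS' _ QP0.
have T00 : 0 <= t0 <= T by rewrite ltW.
have [rF rF0 HF] := F_near_at0 C hFcont Ox0 T00 lF.
have [rO rO0 HO] := open_box hopen Ox0.
have [ra ra0 Ha] := positive_lower_bound ha.
(* rho is the spatial and 2 eta the temporal size of the neighbourhood of the
   maximum point in which everything takes place. *)
have [rho [rho0 rhoF rhoO rhoa rhor]] : exists rho : R,
    [/\ 0 < rho, rho <= rF, rho <= rO, rho <= ra & rho <= r0 / 4].
  exists (Num.min (Num.min rF rO) (Num.min ra (r0 / 4))).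
  split; [|by rewrite !ge_min lexx ?orbT..].
  by rewrite !lt_min rF0 rO0 ra0 divr_gt0.
have [eta [eta0 etarho leta etaa [etat eta1]]] : exists eta : R,
    [/\ 0 < eta, 2 * eta <= rho, 4 * lam * eta <= rho ^+ 2, 2 * eta <= a0 &
      2 * eta < t0 /\ 2 * (lam * eta) <= 1].
  pose e1 := Num.min (rho / 2) (rho ^+ 2 / (4 * lam)).
  pose e2 := Num.min (Num.min (a0 / 2) (t0 / 4)) (2 * lam)^-1.
  exists (Num.min e1 e2).
  have l20 : 0 < 2 * lam by rewrite mulr_gt0.
  have l40 : 0 < 4 * lam by rewrite mulr_gt0.
  have m0 : 0 < Num.min e1 e2.
    by rewrite !lt_min !divr_gt0 ?invr_gt0 ?exprn_gt0.
  have m1 : Num.min e1 e2 <= rho / 2 by rewrite !ge_min lexx.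
  have m2 : Num.min e1 e2 <= rho ^+ 2 / (4 * lam) by rewrite !ge_min lexx orbT.
  have m3 : Num.min e1 e2 <= a0 / 2 by rewrite !ge_min lexx !orbT.
  have m4 : Num.min e1 e2 <= t0 / 4 by rewrite !ge_min lexx !orbT.
  have m5 : Num.min e1 e2 <= (2 * lam)^-1 by rewrite !ge_min lexx !orbT.
  move: m0 m1 m2 m3 m4 m5; move: (Num.min e1 e2) => e.
  rewrite (ler_pdivlMr _ _ l40) -[(2 * lam)^-1]mul1r (ler_pdivlMr _ _ l20) => m0 m1 m2 m3 m4 m5.
  by split; [|lra|rewrite mulrC|lra|split; lra].
have hearly (q : 'rV[R]_N * R) :
    (forall i, `|q.1 ord0 i - x0 ord0 i| <= rho) ->
    t0 - 2 * eta <= q.2 <= t0 - 3 / 8 * eta -> u q < u (x0, t0).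
  move=> qx /andP[q1 q2]; apply: hlt; first by rewrite /strip/=; apply/andP; split; lra.
  split; last by rewrite /= => qt; move: q2; rewrite qt; lra.
  split=> /=; last by apply/andP; split; lra.
  by move=> i; apply: le_trans (Ha i); exact: le_trans rhoa.
have [usc_u vu] := husub.
have [eps [m [q [/andP[e0 elt] qt qrho /andP[s1 s2] [uq qmax]]]]] :=
  localized_max usc_u QP0 hmax hterm l0 eta0 rho0 leta etat hearly eps00.
set phi := testf _ _ _ _ _ _ _ _ in qmax.
have /andP[q20 q2T] := qt.
have Sq : strip T q by rewrite /strip/= !ltW.
have qbox i : `|q.1 ord0 i - x0 ord0 i| <= rho.
  by have := coord_enorm (q.1 - x0) i; rewrite !mxE => /le_trans; exact.
have Oq : Omega q.1 by apply: HO => i; exact: le_trans rhoO.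
have d12 : 0 < (1 / 2 : R) < 1.
  by apply/andP; split; lra.
have := vu phi (contC2_C2 (contC2_testf _ _ _ _ _ _ _ _)) q Oq qt qmax _ d12.
set l := nonloc1 _ _ _ _ + _.
have lC : l <= eps * C.
  apply: (nonlocal_testf_le (hmu _ Oq) e0 _ Sq hmax _ qmax).
    by have /andP[] := d12.
  apply: ltW; apply: le_lt_trans uq.
  by rewrite lerD2l lerN2 -mulrA mulrCA ler_piMr// ltW.
rewrite leNgt => /negP; apply.
pose p := q.1 - x0.
(* The normalized nonlocal term l / eps, to which condition (S') applies. *)
have lE : l = eps * (l / eps) by rewrite mulrCA divff ?mulr1// gt_eqF.
have l'C : l / eps <= C by rewrite ler_pdivrMr// mulrC.
rewrite grad_testf hess_testf lE.
have tt0 : `|q.2 - t0| <= rho.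
  by rewrite ler_norml; apply/andP; split; lra.
have scal : eps * F q.1 q.2 p 1%:M (l / eps) <=
    F q.1 q.2 (eps *: p) (eps *: 1%:M) (eps * (l / eps)).
  apply: (HS eps (r0 / 2)) => //.
  - by rewrite e0.
  - by rewrite divr_gt0//= ltr_pdivrMr// ltr_pMr// ltr1n.
  - rewrite /ball_xt/= -[r0 / 2]gtr0_norm ?divr_gt0// -sqrtr_sqr.
    rewrite ltr_sqrt ?exprn_gt0 ?divr_gt0//.
    have h1 : enorm (q.1 - x0) ^+ 2 <= rho ^+ 2.
      by rewrite ler_pXn2r ?nnegrE ?enorm_ge0// ltW.
    have h2 : (q.2 - t0) ^+ 2 <= rho ^+ 2.
      by rewrite -[leLHS]real_normK ?num_real// ler_pXn2r ?nnegrE// ltW.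
    by nra.
  - by apply: le_trans qrho _; lra.
have ell : F q.1 q.2 p 1%:M C <= F q.1 q.2 p 1%:M (l / eps).
  exact: (elliptic_nonlocal _ hN hFcont hFell Oq).
have near0 : 0 < lam + F q.1 q.2 p 1%:M C.
  have := HF q.1 q.2 p Oq Sq (fun i => le_trans (qbox i) rhoF)
    (le_trans tt0 rhoF).
  rewrite ltr_norml => /(_ _)/andP[|+ _]; last by lra.
  by move=> i; rewrite !mxE; exact: le_trans (qbox i) rhoF.
have time : eps * lam <= dt phi q.
  rewrite dt_testf.
  have : 0 <= eps * (lam * eta) * (m%:R * (q.2 / T) ^+ m.-1) / T.
    apply: divr_ge0; last exact: ltW.
    apply: mulr_ge0; first by apply/ltW/mulr_gt0 => //; exact: mulr_gt0.
    by rewrite mulr_ge0// exprn_ge0// divr_ge0// ltW.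
  move: (eps * (lam * eta) * _ / T) => X X0.
  have -> : 4 * lam * eps + 2 * (4 * lam * eps / eta) * (q.2 - t0) =
      eps * lam + 8 * (eps * lam) * ((q.2 - t0) / eta + 3 / 8) by field; rewrite gt_eqF.
  rewrite -addrA lerDl addr_ge0//; apply: mulr_ge0.
    by rewrite !mulr_ge0// ltW.
  have : - (3 / 8) < (q.2 - t0) / eta by rewrite ltr_pdivlMr// mulNr.
  by rewrite -subr_gt0 opprK => /ltW.
apply: lt_le_trans (lerD time scal); rewrite -mulrDr mulr_gt0//.
by apply: lt_le_trans near0 _; rewrite lerD2l.
Qed.
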